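(* For all lists of integers $c_1,c_2$: if $\mathit{Wf}\ c_1$, $\mathit{Wf}\ c_2$ and $\mathit{UniqueCompPair}\ c_1\ c_2$ hold, then for all integers $\ell_1,\ell_2$ with $\ell_1\in c_1$, $\ell_2\in c_2$ and $\ell_1+\ell_2=0$, we have $\ell_1\notin c_1\bowtie c_2$ and $\ell_2\notin c_1\bowtie c_2$.
   Context: Literals are integers and clauses are finite lists of integers. Lists are written $x::xs$ (cons) and $\mathit{nil}$ (empty); $\mathit{rev}$ reverses a list, $\mathit{app}$ concatenates two lists, $\mathit{abs}$ is the absolute value, and $\in$ denotes list membership. The function $\mathit{auxunion}(c_1,c_2,acc)$ is defined recursively by: - if $c_1=\mathit{nil}$, return $\mathit{app}(\mathit{rev}\ acc, c_2)$; - else if $c_2=\mathit{nil}$, return $\mathit{app}(\mathit{rev}\ acc, c_1)$; - else, with $c_1=x::xs$ and $c_2=y::ys$: - if $\mathit{abs}\,x<\mathit{abs}\,y$, return $\mathit{auxunion}(xs,y::ys,x::acc)$; - else if $\mathit{abs}\,y<\mathit{abs}\,x$, return $\mathit{auxunion}(x::xs,ys,y::acc)$; - else if $x=y$, return $\mathit{auxunion}(xs,ys,x::acc)$; - else return $\mathit{auxunion}(xs,ys,x::y::acc)$. The function $\mathit{union}(c_1,c_2,acc)$ is defined recursively by: - if $c_1=\mathit{nil}$, return $\mathit{app}(\mathit{rev}\ acc,c_2)$; - else if $c_2=\mathit{nil}$, return $\mathit{app}(\mathit{rev}\ acc,c_1)$; - else, with $c_1=x::xs$ and $c_2=y::ys$: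 - if $x+y=0$, return $\mathit{auxunion}(xs,ys,acc)$; - else if $\mathit{abs}\,x<\mathit{abs}\,y$, return $\mathit{union}(xs,y::ys,x::acc)$; - else if $\mathit{abs}\,y<\mathit{abs}\,x$, return $\mathit{union}(x::xs,ys,y::acc)$; - else return $\mathit{union}(xs,ys,x::acc)$. The resolution function is $c_1\bowtie c_2:=\mathit{union}(c_1,c_2,\mathit{nil})$. $\mathit{Wf}\ c$ means the conjunction of three conditions: - $\mathit{NoCompPair}\ c$: there is no literal $x\in c$ with $-x\in c$; - $\mathit{NoDup}\ c$: $c$ has no duplicate elements; - $\mathit{sorted}\ c$: $c$ is sorted in ascending order of absolute value. $\mathit{UniqueCompPair}\ c_1\ c_2$ means that there is exactly one pair $(\ell_1,\ell_2)$ with $\ell_1\in c_1$, $\ell_2\in c_2$ and $\ell_1+\ell_2=0$. *)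

(* Defs.v *)
From Stdlib Require Export ZArith List Sorting.Sorted.
Export ListNotations.
Open Scope Z_scope.

Definition literal := Z.
Definition clause := list literal.

(* Each call shrinks [c1] or [c2] but not always the same one, so the recursion
   is a nested fixpoint: the inner loop shrinks [c2] while [c1] stays in place.
   [auxunion_equation] and [union_equation] are the intended recursive
   equations. *)
Fixpoint auxunion (c1 c2 acc : clause) {struct c1} : clause :=
  let fix loop (c2 acc : clause) {struct c2} : clause :=
    match c1, c2 with
    | [], _ => rev acc ++ c2
    | _, [] => rev acc ++ c1
    | x :: xs, y :: ys =>
        if Z.abs x <? Z.abs y then auxunion xs (y :: ys) (x :: acc)
        else if Z.abs y <? Z.abs x then loop ys (y :: acc)
        else if x =? y then auxunion xs ys (x :: acc)
        else auxunion xs ys (x :: y :: acc)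
    end
  in loop c2 acc.

Fixpoint union (c1 c2 acc : clause) {struct c1} : clause :=
  let fix loop (c2 acc : clause) {struct c2} : clause :=
    match c1, c2 with
    | [], _ => rev acc ++ c2
    | _, [] => rev acc ++ c1
    | x :: xs, y :: ys =>
        if x + y =? 0 then auxunion xs ys acc
        else if Z.abs x <? Z.abs y then union xs (y :: ys) (x :: acc)
        else if Z.abs y <? Z.abs x then loop ys (y :: acc)
        else union xs ys (x :: acc)
    end
  in loop c2 acc.

Lemma auxunion_equation (c1 c2 acc : clause) :
  auxunion c1 c2 acc =
    match c1, c2 with
    | [], _ => rev acc ++ c2
    | _, [] => rev acc ++ c1
    | x :: xs, y :: ys =>
        if Z.abs x <? Z.abs y then auxunion xs (y :: ys) (x :: acc)
        else if Z.abs y <? Z.abs x then auxunion (x :: xs) ys (y :: acc)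
        else if x =? y then auxunion xs ys (x :: acc)
        else auxunion xs ys (x :: y :: acc)
    end.
Proof. destruct c1, c2; reflexivity. Qed.

Lemma union_equation (c1 c2 acc : clause) :
  union c1 c2 acc =
    match c1, c2 with
    | [], _ => rev acc ++ c2
    | _, [] => rev acc ++ c1
    | x :: xs, y :: ys =>
        if x + y =? 0 then auxunion xs ys acc
        else if Z.abs x <? Z.abs y then union xs (y :: ys) (x :: acc)
        else if Z.abs y <? Z.abs x then union (x :: xs) ys (y :: acc)
        else union xs ys (x :: acc)
    end.
Proof. destruct c1, c2; reflexivity. Qed.

Definition resolution (c1 c2 : clause) : clause := union c1 c2 [].

Notation "c1 ⋈ c2" := (resolution c1 c2) (at level 50, left associativity).

(* The case [x = 0] is included, so a clause satisfying this does not contain 0. *)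
Definition NoCompPair (c : clause) : Prop :=
  ~ exists x : literal, In x c /\ In (- x) c.

(* The order on absolute values is not strict. *)
Definition sorted (c : clause) : Prop :=
  Sorted (fun x y : literal => Z.abs x <= Z.abs y) c.

Definition Wf (c : clause) : Prop :=
  NoCompPair c /\ NoDup c /\ sorted c.

(* The unique object is the pair of literals, not a pair of positions. *)
Definition UniqueCompPair (c1 c2 : clause) : Prop :=
  exists! p : literal * literal,
    In (fst p) c1 /\ In (snd p) c2 /\ fst p + snd p = 0.

(* Main.v *)
Require Import Defs.
From Stdlib Require Import Lia.

(** A well-formed clause is strictly sorted by absolute value, so a variable
    occurs in it at most once.  Hence [union] cannot copy one of the two
    complementary literals to the accumulator before both reach the heads of
    the lists; and by uniqueness of the pair it cannot switch to [auxunion]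
    before that either. *)

Definition abs_lt (x y : literal) : Prop := Z.abs x < Z.abs y.

(** Literals of equal absolute value are equal or opposite; [NoDup] excludes the first case and
    [NoCompPair] the second. *)
Lemma Wf_StronglySorted (c : clause) : Wf c -> StronglySorted abs_lt c.
Proof.
  intros (Hcomp & Hdup & Hsort).
  apply Sorted_StronglySorted in Hsort; [| intros x y z; lia].
  induction Hsort as [| x c Hsort IH Hx]; constructor.
  - apply IH.
    + intros (y & Hy & Hy'); apply Hcomp; exists y; simpl; auto.
    + now inversion Hdup.
  - rewrite Forall_forall in *; intros y Hy.
    specialize (Hx y Hy); unfold abs_lt.
    enough (Z.abs x <> Z.abs y) by lia; intros Heq.
    inversion Hdup as [| ? ? Hnot _]; subst.
    assert (y = x \/ y = - x) as [-> | ->] by lia; [contradiction |].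
    apply Hcomp; exists x; simpl; auto.
Qed.

Lemma StronglySorted_cons_In (x : literal) (c : clause) :
  StronglySorted abs_lt (x :: c) ->
  StronglySorted abs_lt c /\ forall y, In y c -> Z.abs x < Z.abs y.
Proof.
  intros H; apply StronglySorted_inv in H as [Hc Hx].
  rewrite Forall_forall in Hx; auto.
Qed.

(** After the switch to [auxunion] it is enough that no new literal appears: a variable absent from
    the accumulator and from both tails stays absent. *)
Lemma In_auxunion (z : literal) (c1 c2 acc : clause) :
  In z (auxunion c1 c2 acc) -> In z acc \/ In z c1 \/ In z c2.
Proof.
  revert c2 acc; induction c1 as [| x xs IH1]; intros c2.
  - intros acc; rewrite auxunion_equation, in_app_iff, <- in_rev; tauto.
  - induction c2 as [| y ys IH2]; intros acc; rewrite auxunion_equation.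
    + rewrite in_app_iff, <- in_rev; tauto.
    + destruct (Z.abs x <? Z.abs y); [| destruct (Z.abs y <? Z.abs x);
        [| destruct (x =? y)]];
        intros H; first [apply IH2 in H | apply IH1 in H]; simpl in *; tauto.
Qed.

(** Comparing absolute values excludes [l] and [- l] at once. Uniqueness is phrased relative to [l]
    so that it passes to tails, and the condition on [acc] is the loop invariant. *)
Lemma union_abs_neq (l z : literal) (c1 c2 acc : clause) :
  StronglySorted abs_lt c1 -> StronglySorted abs_lt c2 ->
  In l c1 -> In (- l) c2 ->
  (forall x, In x c1 -> In (- x) c2 -> x = l) ->
  (forall x, In x acc -> Z.abs x <> Z.abs l) ->
  In z (union c1 c2 acc) -> Z.abs z <> Z.abs l.
Proof.
  revert c2 acc; induction c1 as [| x xs IH1]; [contradiction |].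
  induction c2 as [| y ys IH2]; [contradiction |].
  intros acc S1 S2 L1 L2 Huniq Hacc; rewrite union_equation.
  destruct (StronglySorted_cons_In _ _ S1) as [S1' B1].
  destruct (StronglySorted_cons_In _ _ S2) as [S2' B2].
  assert (D1 : l = x \/ In l xs /\ Z.abs x < Z.abs l)
    by (destruct L1; auto).
  assert (D2 : - l = y \/ In (- l) ys /\ Z.abs y < Z.abs l)
    by (destruct L2 as [| H]; [auto | right; specialize (B2 _ H); split; auto; lia]).
  destruct (Z.eqb_spec (x + y) 0) as [Hxy | Hxy].
  (* Opposite heads must be [l] and [- l]; both tails then have strictly larger absolute values. *)
  { assert (Hxl : x = l) by (apply Huniq; simpl; [| left; lia]; auto).
    intros [H | [H | H]]%In_auxunion; [auto | apply B1 in H | apply B2 in H]; lia. }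
  destruct (Z.ltb_spec (Z.abs x) (Z.abs y));
    [| destruct (Z.ltb_spec (Z.abs y) (Z.abs x))].
  (* Since [- l] lies in [y :: ys], [Z.abs x < Z.abs y <= Z.abs l], so [l] is still in [xs]. The
     next case is symmetric. *)
  - apply IH1; auto.
    + destruct D1 as [| []]; [lia | auto].
    + intros; apply Huniq; simpl; auto.
    + intros w [<- | Hw]; [lia | auto].
  - apply IH2; auto.
    + destruct D2 as [| []]; [lia | auto].
    + intros; apply Huniq; simpl; auto.
    + intros w [<- | Hw]; [lia | auto].
  (* The heads have equal absolute value but are not opposite. If either were [l] or [- l], strict
     sorting would make the other its opposite, so both [l] and [- l] lie in the tails. *)
  - apply IH1; auto.
    + destruct D1 as [| []]; [lia | auto].
    + destruct D2 as [| []]; [lia | auto].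
    + intros; apply Huniq; simpl; auto.
    + intros w [<- | Hw]; [lia | auto].
Qed.

Theorem theorem2 :
  forall c1 c2 : clause,
    Wf c1 -> Wf c2 -> UniqueCompPair c1 c2 ->
    forall l1 l2 : literal,
      In l1 c1 -> In l2 c2 -> l1 + l2 = 0 ->
      ~ In l1 (c1 ⋈ c2) /\ ~ In l2 (c1 ⋈ c2).
Proof.
  intros c1 c2 W1 W2 ([p1 p2] & _ & Huniq) l1 l2 H1 H2 Hsum.
  assert (l2 = - l1) as -> by lia.
  assert (Habs : forall z, In z (c1 ⋈ c2) -> Z.abs z <> Z.abs l1).
  { intros z; apply union_abs_neq; auto using Wf_StronglySorted.
    intros x Hx Hx'.
    assert (E : (p1, p2) = (x, - x)) by (apply Huniq; simpl; auto with zarith).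
    assert (E' : (p1, p2) = (l1, - l1)) by (apply Huniq; simpl; auto).
    congruence. }
  split; intros H; apply Habs in H; lia.
Qed.
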